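(* Let $(\Gamma,\prec)$ be a planar graph with set of vertices $V(\Gamma)$. Then the relation $\prec_V$ on $V(\Gamma)$ defined for distinct vertices $v_1,v_2$ by $$v_1\prec_V v_2\iff v_1\to v_2\ \text{ or }\ \overline{o_{max}(v_1)}\prec\overline{i_{min}(v_2)}$$ is a linear order on $V(\Gamma)$.
   Context: A graph is a triple $(H,P,\sigma)$ with $H$ a finite set (half-edges), $P$ a partition of $H$ into nonempty blocks (vertices), $\sigma$ an involution of $H$ (its orbits are the edges), such that a vertex containing a two-element $\sigma$-orbit equals that orbit. $\overline h$ denotes the edge containing the half-edge $h$. An orientation $\mathrm{sgn}:H\to\{+,-\}$ takes different values on the two elements of each two-element orbit; $In(v),Out(v)$ are the sets of half-edges in $v$ of sign $+$, $-$. The graph is directed if all $In(v),Out(v)$ are nonempty. The source (target) of an edge is the vertex containing its $-$ ($+$) half-edge, if there is one. A directed path is a sequence of edges $e_1,\dots,e_n$, $n\ge1$, with the target of $e_i$ equal to the source of $e_{i+1}$. For edges, $e\to e'$ means there is a directed path starting with $e$ and ending with $e'$; for vertices, $v\to v'$ means there is a directed path $e_1,\dots,e_n$ with $v$ the source of $e_1$ and $v'$ the target of $e_n$. A planar graph is a directed graph with a linear order $\prec$ on its set of edges such that for distinct edges: $(P_1)$ $e_1\to e_2$ implies $e_1\prec e_2$; $(P_2)$ if $e_1\to e_2$ and $e_1\prec e_3\prec e_2$, then $e_3\to e_2$ or $e_1\to e_3$. $In(v)$ and $Out(v)$ are linearly ordered by $\prec$ applied to the edges containing their elements; $i_{min}(v)=\min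 In(v)$ and $o_{max}(v)=\max Out(v)$. *)

(* Defs.v *)
From mathcomp Require Import all_boot.

Set Implicit Arguments.
Unset Strict Implicit.
Unset Printing Implicit Defensive.

(* Strict linear order: asymmetry follows from the first two clauses. *)
Definition linear_order (T : Type) (R : T -> T -> Prop) : Prop :=
  [/\ forall x, ~ R x x,
      forall x y z, R x y -> R y z -> R x z
    & forall x y, x <> y -> R x y \/ R y x].

Record graph := Graph {
  half_edge : finType;
  vertex_set : {set {set half_edge}};
  sigma : half_edge -> half_edge;
  vertex_partition : partition vertex_set [set: half_edge];
  sigma_involutive : involutive sigma;
  vertex_with_loop : forall (v : {set half_edge}) (h : half_edge),
    v \in vertex_set -> sigma h != h -> [set h; sigma h] \subset v ->
    v = [set h; sigma h]
}.

Section Graph.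
Variable G : graph.

Definition edge_set : {set {set half_edge G}} :=
  [set [set h; sigma h] | h : half_edge G].

Definition vertex := {v : {set half_edge G} | v \in vertex_set G}.

Definition edge := {e : {set half_edge G} | e \in edge_set}.

Lemma orbit_in_edge_set (h : half_edge G) : [set h; sigma h] \in edge_set.
Proof. by apply/imsetP; exists h. Qed.

Definition edge_of (h : half_edge G) : edge :=
  exist _ [set h; sigma h] (orbit_in_edge_set h).

End Graph.

(* The sign + is [true], the sign - is [false]. *)
Record directed_graph := DirectedGraph {
  dgraph :> graph;
  sgn : half_edge dgraph -> bool;
  sgn_orientation : forall h, sigma h != h -> sgn (sigma h) != sgn h;
  directed_in : forall v : vertex dgraph, exists h, (h \in val v) && sgn h;
  directed_out : forall v : vertex dgraph, exists h, (h \in val v) && ~~ sgn h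
}.

Section DirectedGraph.
Variable G : directed_graph.

Definition In (v : vertex G) : {set half_edge G} :=
  [set h in val v | sgn h].

Definition Out (v : vertex G) : {set half_edge G} :=
  [set h in val v | ~~ sgn h].

(* Sources and targets are partial (an edge may be a single half-edge), so
   they are given as relations; an edge has at most one of each. *)
Definition is_source (v : vertex G) (e : edge G) : bool :=
  [exists h in val e, ~~ sgn h && (h \in val v)].

Definition is_target (v : vertex G) (e : edge G) : bool :=
  [exists h in val e, sgn h && (h \in val v)].

Definition follows (e e' : edge G) : bool :=
  [exists v : vertex G, is_target v e && is_source v e'].

(* The directed path with edges [e :: p] starts with [e] and ends with
   [last e p]; in particular it has at least one edge. *)
Definition edge_reach (e e' : edge G) : Prop :=
  exists p : seq (edge G), path follows e p /\ last e p = e'.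

Definition vertex_reach (v v' : vertex G) : Prop :=
  exists (e : edge G) (p : seq (edge G)),
    [/\ path follows e p, is_source v e & is_target v' (last e p)].

End DirectedGraph.

Record planar_graph := PlanarGraph {
  pgraph :> directed_graph;
  prec : rel (edge pgraph);
  prec_linear : linear_order (fun e e' => prec e e');
  planar_P1 : forall e1 e2 : edge pgraph,
    e1 != e2 -> edge_reach e1 e2 -> prec e1 e2;
  planar_P2 : forall e1 e2 e3 : edge pgraph,
    edge_reach e1 e2 -> prec e1 e3 -> prec e3 e2 ->
    edge_reach e3 e2 \/ edge_reach e1 e3
}.

Section PlanarGraph.
Variable G : planar_graph.

Definition preceq (e e' : edge G) : bool := (e == e') || prec e e'.

(* [extremum ord h0 A F] is an element of A minimizing F for ord, given some h0
   in A; the witnesses [xchoose _] do not affect the result. The order on In(v)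
   and Out(v) is that of the edges: two half-edges of the same sign belong to
   distinct edges. *)
Definition i_min (v : vertex G) : half_edge G :=
  extremum preceq (xchoose (directed_in v)) (mem (In v)) (@edge_of G).

Definition o_max (v : vertex G) : half_edge G :=
  extremum (fun e e' => preceq e' e) (xchoose (directed_out v)) (mem (Out v))
    (@edge_of G).

Definition vertex_prec (v1 v2 : vertex G) : Prop :=
  v1 <> v2 /\
  (vertex_reach v1 v2 \/ prec (edge_of (o_max v1)) (edge_of (i_min v2))).

End PlanarGraph.

(* Main.v *)
From mathcomp Require Import all_boot.
Require Import Defs.

Set Implicit Arguments.
Unset Strict Implicit.
Unset Printing Implicit Defensive.

(** Write I(v) and O(v) for the edges of i_min v and o_max v.  Edge
    reachability is the reflexive-transitive closure of [follows], so by (P1)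
    it refines the reflexive closure of the order on edges; in particular it is
    antisymmetric.  Moreover every edge entering v reaches every edge leaving v,
    and conversely a nontrivial path that starts with an edge entering v
    continues through v, a nontrivial path that ends with an edge leaving v
    comes through v ([connect_first], [connect_last]), because an edge has at
    most one source and at most one target.

    Totality ([vertex_total]): if O(v) = I(w), then v reaches w.  If neither
    O(v) <= I(w) nor O(w) <= I(v), the intervals [I(v), O(v)] and [I(w), O(w)]
    overlap.  When the second one starts later, I(v) < I(w) < O(v), and since
    I(v) reaches O(v), (P2) gives a path from I(v) to I(w) or from I(w) to O(v).
    The first passes through v, the second through w and then v, so the two
    vertices are related by a path.

    Transitivity is clear when both relations hold for the same reason: two paths
    compose, and O(u) < I(v) <= O(v) < I(w).  In the mixed cases
    ([reach_prec_trans], [prec_reach_trans]) either O(u) < I(w), or I(w) = O(u)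
    and u reaches w, or I(w) < O(u).  In the last case (P2) gives two
    alternatives as above: one yields a path from u to w, the other would lead to a
    path between two edges whose order is the opposite one.  That u and w are
    distinct is asymmetry ([vertex_prec_asym]). *)

(** * Paths through a vertex *)

Section DirectedGraph.
Variable G : directed_graph.
Implicit Types (v w : vertex G) (e f : edge G) (h k : half_edge G).

Local Notation "e ~> f" := (connect (@follows G) e f) (at level 70).

Lemma edge_reachP e f : edge_reach e f <-> e ~> f.
Proof.
split=> [[p [pth <-]]|/connectP [p pth ->]]; last by exists p.
by apply/connectP; exists p.
Qed.

Lemma vertex_reachP v w :
  vertex_reach v w <->
  exists e f, [/\ is_source v e, is_target w f & e ~> f].
Proof.
split=> [[e [p [pth src tgt]]]|[e [f [src tgt /connectP [p pth ef]]]]].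
  by exists e, (last e p); split=> //; apply/connectP; exists p.
by exists e, p; rewrite -ef.
Qed.

(** Two distinct half-edges of one edge are exchanged by the involution, hence
    have opposite signs.  This is why sources and targets are unique. *)
Lemma half_edge_inj e h k :
  h \in val e -> k \in val e -> sgn h = sgn k -> h = k.
Proof.
case: e => /= _ /imsetP [x _ ->].
rewrite !inE => /orP [] /eqP -> /orP [] /eqP -> //.
  case: (eqVneq (sigma x) x) => [-> //|/sgn_orientation /eqP neq eq].
  by case: neq.
by case: (eqVneq (sigma x) x) => [-> //|/sgn_orientation /eqP].
Qed.

Lemma vertex_inj h v w : h \in val v -> h \in val w -> v = w.
Proof.
have /and3P [_ tI _] := vertex_partition G.
move=> hv hw; apply: val_inj.
by rewrite -(def_pblock tI (valP v) hv) (def_pblock tI (valP w) hw).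
Qed.

Lemma source_inj e v w : is_source v e -> is_source w e -> v = w.
Proof.
move=> /exists_inP [h he /andP [/negbTE sh hv]].
move=> /exists_inP [k ke /andP [/negbTE sk kw]].
have hk : h = k by apply: half_edge_inj he ke _; rewrite sh sk.
by apply: vertex_inj hv _; rewrite hk.
Qed.

Lemma target_inj e v w : is_target v e -> is_target w e -> v = w.
Proof.
move=> /exists_inP [h he /andP [sh hv]] /exists_inP [k ke /andP [sk kw]].
have hk : h = k by apply: half_edge_inj he ke _; rewrite sh sk.
by apply: vertex_inj hv _; rewrite hk.
Qed.

Lemma is_targetP v e :
  reflect (exists2 h, h \in In v & e = edge_of h) (is_target v e).
Proof.
apply: (iffP exists_inP) => [[h he /andP [sh hv]]|[h]].
  exists h; first by rewrite inE hv.
  apply: val_inj; case: e he => /= _ /imsetP [x _ ->].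
  rewrite !inE => /orP [] /eqP -> //.
  by rewrite sigma_involutive setUC.
by rewrite inE => /andP [hv sh] ->; exists h; rewrite ?sh //= !inE eqxx.
Qed.

Lemma is_sourceP v e :
  reflect (exists2 h, h \in Out v & e = edge_of h) (is_source v e).
Proof.
apply: (iffP exists_inP) => [[h he /andP [sh hv]]|[h]].
  exists h; first by rewrite inE hv.
  apply: val_inj; case: e he => /= _ /imsetP [x _ ->].
  rewrite !inE => /orP [] /eqP -> //.
  by rewrite sigma_involutive setUC.
by rewrite inE => /andP [hv sh] ->; exists h; rewrite ?sh //= !inE eqxx.
Qed.

Lemma connect_through v e f : is_target v e -> is_source v f -> e ~> f.
Proof. by move=> ve vf; apply/connect1/existsP; exists v; rewrite ve. Qed.

(** The vertex where the first step of the path takes place is a target of e,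
    so it can only be v. *)
Lemma connect_first v e f : is_target v e -> e ~> f -> e != f ->
  exists2 e', is_source v e' & e' ~> f.
Proof.
move=> ve /connectP [[|e' p] /= + ->]; first by rewrite eqxx.
case/andP=> /existsP [w /andP [we we']] pth _.
exists e'; first by rewrite (target_inj ve we).
by apply/connectP; exists p.
Qed.

Lemma connect_last v e f : is_source v f -> e ~> f -> e != f ->
  exists2 f', is_target v f' & e ~> f'.
Proof.
move=> vf /connectP [p]; case/lastP: p => [|p f'] /=.
  by move=> _ ->; rewrite eqxx.
rewrite rcons_path last_rcons => /andP [pth /existsP [w /andP [wl wf']]] ff' _.
exists (last e p); last by apply/connectP; exists p.
by rewrite ff' in vf; rewrite (source_inj vf wf').
Qed.

End DirectedGraph.

(** * The linear order on edges *)

Section PlanarGraph.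
Variable G : planar_graph.
Implicit Types (u v w : vertex G) (e f g : edge G).

Local Notation "e ~> f" := (connect (@follows G) e f) (at level 70).
Local Notation I v := (edge_of (i_min v)).
Local Notation O v := (edge_of (o_max v)).

Lemma prec_irr e : ~ prec e e.
Proof. by case: (prec_linear G). Qed.

Lemma prec_trans e f g : prec e f -> prec f g -> prec e g.
Proof. by case: (prec_linear G) => _ + _; apply. Qed.

Lemma preceq_refl : reflexive (@preceq G).
Proof. by move=> e; rewrite /preceq eqxx. Qed.

Lemma preceq_trans : transitive (@preceq G).
Proof.
move=> f e g /orP [/eqP -> //|ef] /orP [/eqP <-|fg]; rewrite /preceq.
  by rewrite ef orbT.
by rewrite (prec_trans ef fg) orbT.
Qed.

Lemma preceq_total : total (@preceq G).
Proof.
move=> e f; rewrite /preceq; case: (eqVneq e f) => //= /eqP nef.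
by case: (prec_linear G) => _ _ /(_ _ _ nef) [] ->; rewrite ?orbT.
Qed.

Lemma prec_preceq_trans e f g : prec e f -> preceq f g -> prec e g.
Proof. by move=> ef /orP [/eqP <- //|]; apply: prec_trans. Qed.

Lemma preceq_prec_trans e f g : preceq e f -> prec f g -> prec e g.
Proof. by move=> /orP [/eqP <- //|ef]; apply: prec_trans. Qed.

Lemma connect_preceq e f : e ~> f -> preceq e f.
Proof.
move=> ef; rewrite /preceq; case: eqVneq => //= nef.
by apply: planar_P1 => //; apply/edge_reachP.
Qed.

Lemma connect_not_prec e f : e ~> f -> ~ prec f e.
Proof.
by move=> /connect_preceq ef fe; apply: (prec_irr (prec_preceq_trans fe ef)).
Qed.

Lemma connect_anti e f : e ~> f -> f ~> e -> e = f.
Proof.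
by move=> /connect_preceq /orP [/eqP //|fe] /connect_not_prec.
Qed.

Lemma connect_between e f g : e ~> f -> prec e g -> prec g f ->
  g ~> f \/ e ~> g.
Proof.
move=> /edge_reachP ef eg gf.
by case: (planar_P2 ef eg gf) => /edge_reachP; [left|right].
Qed.

(** * Extremal edges at a vertex *)

Lemma i_minP v :
  is_target v (I v) /\ forall e, is_target v e -> preceq (I v) e.
Proof.
rewrite /i_min; case: extremumP => [||||h hv hmin].
- exact: preceq_refl.
- exact: preceq_trans.
- exact: preceq_total.
- by have := xchooseP (directed_in v); rewrite /= inE.
split; first by apply/is_targetP; exists h.
by move=> e /is_targetP [k kv ->]; apply: hmin.
Qed.

Lemma o_maxP v :
  is_source v (O v) /\ forall e, is_source v e -> preceq e (O v).
Proof.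
rewrite /o_max; case: extremumP => [||||h hv hmax].
- exact: preceq_refl.
- by move=> f e g fe gf; apply: preceq_trans gf fe.
- by move=> e f; apply: preceq_total.
- by have := xchooseP (directed_out v); rewrite /= inE.
split; first by apply/is_sourceP; exists h.
by move=> e /is_sourceP [k kv ->]; apply: hmax.
Qed.

Lemma I_target v : is_target v (I v). Proof. by case: (i_minP v). Qed.
Lemma O_source v : is_source v (O v). Proof. by case: (o_maxP v). Qed.

Lemma connect_I v e : is_source v e -> I v ~> e.
Proof. exact/connect_through/I_target. Qed.

Lemma connect_O v e : is_target v e -> e ~> O v.
Proof. by move/connect_through; apply; apply: O_source. Qed.

Lemma connect_IO v : I v ~> O v.
Proof. exact/connect_I/O_source. Qed.

(** * Asymmetry *)

(** A closed walk through v and w is constant by antisymmetry, so v and w are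
    sources of the same edge. *)
Lemma vertex_reach_anti v w : vertex_reach v w -> vertex_reach w v -> v = w.
Proof.
move=> /vertex_reachP [e [f [ve wf ef]]] /vertex_reachP [f' [e' [wf' ve' fe]]].
have ff' := connect_through wf wf'; have ee' := connect_through ve' ve.
have eqf : e = f'.
  apply: connect_anti; first exact: connect_trans ef ff'.
  exact: connect_trans fe ee'.
by rewrite -eqf in wf'; apply: source_inj ve wf'.
Qed.

Lemma vertex_reach_trans u v w :
  vertex_reach u v -> vertex_reach v w -> vertex_reach u w.
Proof.
move=> /vertex_reachP [e [f [ue vf ef]]] /vertex_reachP [f' [g [vf' wg fg]]].
apply/vertex_reachP; exists e, g; split=> //.
exact/(connect_trans ef)/(connect_trans _ fg)/connect_through/vf'.
Qed.

(** A path from v to w extends to one from I(v) to O(w). *)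
Lemma reach_prec_asym v w : vertex_reach v w -> ~ prec (O w) (I v).
Proof.
move=> /vertex_reachP [e [f [ve wf ef]]]; apply: connect_not_prec.
exact: connect_trans (connect_I ve) (connect_trans ef (connect_O wf)).
Qed.

Lemma vertex_prec_asym v w : vertex_prec v w -> ~ vertex_prec w v.
Proof.
case=> nvw [rvw|pvw] [_ [rwv|pwv]].
- exact/nvw/vertex_reach_anti.
- exact: reach_prec_asym rvw pwv.
- exact: reach_prec_asym rwv pvw.
have lt := prec_preceq_trans pvw (connect_preceq (connect_IO w)).
exact: connect_not_prec (connect_IO v) (prec_trans lt pwv).
Qed.

(** * Totality *)

Lemma reach_from_I v w : I v ~> I w -> v <> w -> vertex_reach v w.
Proof.
move=> vw nvw; have [|e ve ew] := connect_first (I_target v) vw.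
  apply/eqP => eqI; apply: nvw.
  by apply: target_inj (I_target v) _; rewrite eqI; apply: I_target.
by apply/vertex_reachP; exists e, (I w); split=> //; apply: I_target.
Qed.

Lemma reach_to_O v w : O v ~> O w -> v <> w -> vertex_reach v w.
Proof.
move=> vw nvw; have [|f wf vf] := connect_last (O_source w) vw.
  apply/eqP => eqO; apply: nvw.
  by apply: source_inj (O_source v) _; rewrite eqO; apply: O_source.
by apply/vertex_reachP; exists (O v), f; split=> //; apply: O_source.
Qed.

(** The common starting point of totality and transitivity: unless v is already
    below w, the edge I(w) lies strictly before O(v), and (P2) can be applied
    inside [I(v), O(v)] or [I(w), O(w)]. *)
Lemma vertex_prec_or_lt v w : v <> w -> vertex_prec v w \/ prec (I w) (O v).
Proof.
move=> nvw; case: (eqVneq (I w) (O v)) => [eqIO|/eqP nIO].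
  left; split=> //; left; apply/vertex_reachP; exists (O v), (I w).
  by split; rewrite ?eqIO ?connect0 ?O_source // -eqIO I_target.
case: (prec_linear G) => _ _ /(_ _ _ nIO) [lt|lt]; [by right | left].
by split=> //; right.
Qed.

(** (P2) applied to I(w) inside [I(v), O(v)].  A path from I(w) to O(v) leaves w
    and enters v before reaching O(v), so its middle part runs from w to v. *)
Lemma overlap_total v w : v <> w -> prec (I v) (I w) -> prec (I w) (O v) ->
  vertex_reach v w \/ vertex_reach w v.
Proof.
move=> nvw lt1 lt2.
case: (connect_between (connect_IO v) lt1 lt2) => [IO|II]; last first.
  by left; apply: reach_from_I.
have [|f vf If] := connect_last (O_source v) IO.
  by apply/eqP => eqIO; rewrite eqIO in lt2; apply: prec_irr lt2.
have [|e we ef] := connect_first (I_target w) If.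
  by apply/eqP=> eqf; rewrite -eqf in vf; apply/nvw/(target_inj vf)/I_target.
by right; apply/vertex_reachP; exists e, f.
Qed.

Lemma vertex_total v w : v <> w -> vertex_prec v w \/ vertex_prec w v.
Proof.
move=> nvw; have nwv := nesym nvw.
case: (vertex_prec_or_lt nvw) => [|ltwv]; first by left.
case: (vertex_prec_or_lt nwv) => [|ltvw]; first by right.
have reach : vertex_reach v w \/ vertex_reach w v.
  have nI : I v <> I w.
    move=> eqI; apply: nvw; apply: target_inj (I_target v) _.
    by rewrite eqI; apply: I_target.
  case: (prec_linear G) => _ _ /(_ _ _ nI) [] lt; first exact: overlap_total.
  by apply/or_comm; apply: overlap_total.
by case: reach => r; [left|right]; split=> //; left.
Qed.

(** * Transitivity *)

(** If I(w) < O(u), then I(w) lies inside [I(u), O(u)], because the path from u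
    to v extends to a path from I(u) to O(v), and O(v) < I(w).  Of the
    alternatives in (P2), a path from I(u) to I(w) gives one from u to w, and a
    path from I(w) to O(u) contradicts O(v) < I(w). *)
Lemma reach_prec_trans u v w : u <> w ->
  vertex_reach u v -> prec (O v) (I w) -> vertex_prec u w.
Proof.
move=> nuw /vertex_reachP [e [f [ue vf ef]]] lt.
case: (vertex_prec_or_lt nuw) => // ltwu.
have eO : e ~> O v := connect_trans ef (connect_O vf).
have ltuw : prec (I u) (I w).
  apply: preceq_prec_trans lt.
  exact: connect_preceq (connect_trans (connect_I ue) eO).
case: (connect_between (connect_IO u) ltuw ltwu) => [IO|II]; last first.
  by split=> //; left; apply: reach_from_I.
(* The path from I w to O u enters u, so it can be diverted along e to O v. *)
have [|g ug Ig] := connect_last (O_source u) IO.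
  by apply/eqP => eqIO; rewrite eqIO in ltwu; apply: prec_irr ltwu.
case: (@connect_not_prec (I w) (O v)) => //.
exact: connect_trans Ig (connect_trans (connect_through ug ue) eO).
Qed.

(** The mirror image of [reach_prec_trans] under reversal of orientation and
    order: here (P2) is applied to O(u) inside [I(w), O(w)]. *)
Lemma prec_reach_trans u v w : u <> w ->
  prec (O u) (I v) -> vertex_reach v w -> vertex_prec u w.
Proof.
move=> nuw lt /vertex_reachP [e [f [ve wf ef]]].
case: (vertex_prec_or_lt nuw) => // ltwu.
have If : I v ~> f := connect_trans (connect_I ve) ef.
have ltuw : prec (O u) (O w).
  apply: prec_preceq_trans lt _.
  exact: connect_preceq (connect_trans If (connect_O wf)).
case: (connect_between (connect_IO w) ltwu ltuw) => [OO|IO].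
  by split=> //; left; apply: reach_to_O.
(* The path from I w to O u leaves w, so f can be continued along it to O u. *)
have [|g wg gO] := connect_first (I_target w) IO.
  by apply/eqP => eqIO; rewrite eqIO in ltwu; apply: prec_irr ltwu.
case: (@connect_not_prec (I v) (O u)) => //.
exact: connect_trans If (connect_trans (connect_through wf wg) gO).
Qed.

Lemma vertex_prec_trans u v w :
  vertex_prec u v -> vertex_prec v w -> vertex_prec u w.
Proof.
move=> uv vw.
have nuw : u <> w by move=> eq; rewrite -eq in vw; apply: vertex_prec_asym uv vw.
case: uv vw => _ [ruv|puv] [_ [rvw|pvw]].
- by split=> //; left; apply: vertex_reach_trans rvw.
- exact: reach_prec_trans ruv pvw.
- exact: prec_reach_trans puv rvw.
split=> //; right; apply: prec_trans puv _.
exact: preceq_prec_trans (connect_preceq (connect_IO v)) pvw.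
Qed.

End PlanarGraph.

(** * The order on vertices *)

Theorem proposition3p3p2 (Gamma : planar_graph) :
  linear_order (@vertex_prec Gamma).
Proof.
split; [by move=> v [] | exact: vertex_prec_trans | exact: vertex_total].
Qed.
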